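(* Let $m \ge n \ge 2$ be two integers with $\frac{\log m}{\log n}$ irrational. Then there are only two possible cases, i.e. one of the following holds: (1) $\frac1n$ is $m$-far; (2) there exist positive integers $a,b\ge 1$ such that $(m^a,n^b)$ is a good pair.
   Context: For an integer $q\ge 2$, a real number $\delta$ is called $q$-far if there exists a constant $C>0$ (possibly depending on $\delta$) such that $\left|\delta-\frac{k}{q^s}\right|\ge \frac{C}{q^s}$ for all integers $s\ge 0$ and all $k\in\mathbb{Z}$. Good pair: let $M,L\ge 2$ be integers with prime factorizations $L=p_1^{a_1}\cdots p_N^{a_N}$ and $M=p_1^{b_1}\cdots p_N^{b_N}$, where $p_1,\dots,p_N$ are the distinct primes dividing $ML$ and $a_i,b_i\ge 0$, such that $b_i>0$ whenever $a_i>0$. The pair $(M,L)$ is a good pair if (i) $M>L$; and (ii) $b_i\ge a_i$ for all $1\le i\le N$, and there exists some $i\in\{1,\dots,N\}$ with $a_i=b_i>0$. *)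

(* Defs.v *)
From mathcomp Require Import all_boot all_order all_algebra.
From mathcomp Require Import reals exp.

Set Implicit Arguments.
Unset Strict Implicit.
Unset Printing Implicit Defensive.

Import Order.TTheory GRing.Theory Num.Theory.

Local Open Scope ring_scope.

(* Meaningful for q >= 2; the constant C may depend on delta. *)
Definition is_far (R : realType) (q : nat) (delta : R) : Prop :=
  exists2 C : R, 0 < C &
    forall (s : nat) (k : int),
      C / q%:R ^+ s <= `|delta - k%:~R / q%:R ^+ s|.

(* The p_i are the elements of primes (M * L), with a_i = logn p_i L and
   b_i = logn p_i M. *)
Definition good_pair (M L : nat) : Prop :=
  [/\ (2 <= M)%N /\ (2 <= L)%N,
      forall p, p \in primes (M * L)%N -> (0 < logn p L)%N -> (0 < logn p M)%N,
      (L < M)%N,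
      forall p, p \in primes (M * L)%N -> (logn p L <= logn p M)%N &
      exists2 p, p \in primes (M * L)%N &
        logn p L = logn p M /\ (0 < logn p M)%N].

(* Main.v *)
(* If some prime p divides n but not m, then p never divides m^s - k n, so
   this integer is nonzero and |1/n - k/m^s| >= 1/(n m^s): case (1) holds with
   C = 1/n. Otherwise pick a prime p dividing n that minimizes the ratio
   v_p(m) / v_p(n) of valuations, and set a = v_p(n), b = v_p(m). Minimality
   makes n^b divide m^a, with equality of valuations at p; and m^a = n^b would
   force log m / log n = b / a to be rational. *)
Require Import Defs.
From mathcomp Require Import all_boot all_order all_algebra.
From mathcomp Require Import reals exp.

Import Order.TTheory GRing.Theory Num.Theory.

Local Open Scope ring_scope.

Lemma is_far_inv (R : realType) (m n p : nat) :
  (0 < n)%N -> (p %| n)%N -> prime p -> ~~ (p %| m)%N ->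
  is_far m (n%:R^-1 : R).
Proof.
move=> n0 pn pp pm.
have m0 : (0 < m)%N by case: m pm => //; rewrite dvdn0.
exists n%:R^-1; first by rewrite invr_gt0 ltr0n.
move=> s k.
have mR0 : 0 < (m%:R : R) ^+ s by rewrite exprn_gt0 ?ltr0n.
have nR0 : 0 < n%:R :> R by rewrite ltr0n.
(* Clearing the denominators [n] and [m ^ s] leaves [1 <= |m ^ s - k * n|], a bound that any nonzero
   integer satisfies. *)
rewrite ler_pdivrMr // -[leLHS]mul1r ler_pdivrMr //.
rewrite -[X in _ * X * _](gtr0_norm mR0) -[X in _ * X](gtr0_norm nR0) -!normrM.
rewrite mulrBl divfK ?gt_eqF // mulrBl mulrAC mulVf ?gt_eqF // mul1r.
have -> : m%:R ^+ s - k%:~R * n%:R = ((m ^ s)%N%:Z - k * n%:Z)%:~R :> R.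
  by rewrite intrB intrM -!pmulrn natrX.
apply: norm_intr_ge1; first exact: intr_int.
rewrite intr_eq0 subr_eq0; apply: contra pm => /eqP msE.
suff : (p %| m ^ s)%N by rewrite Euclid_dvdX // => /andP [].
by have := congr1 absz msE; rewrite abszM /= => ->; apply: dvdn_mull.
Qed.

(** Ratios [f x / g x] are compared by cross-multiplication, to stay in [nat]. The induction keeps
    the better of the head and the minimizer of the tail. *)
Lemma exists_min_ratio (T : eqType) (f g : T -> nat) (s : seq T) :
  s != [::] -> {in s, forall x, (0 < g x)%N} ->
  exists2 x, x \in s & {in s, forall y, f x * g y <= f y * g x}%N.
Proof.
elim: s => [//|x s IHs] _ g_gt0.
have [s0 | s_neq0] := eqVneq s [::].
  by exists x; rewrite s0 ?mem_seq1 // => y; rewrite mem_seq1 => /eqP ->.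
have [|y ys ymin] := IHs s_neq0.
  by move=> z zs; apply: g_gt0; rewrite inE zs orbT.
have [xy | yx] := leqP (f x * g y) (f y * g x).
  exists x; first exact: mem_head.
  move=> z; rewrite inE => /predU1P [-> // | zs].
  (* Transitivity through [y]: the factor [g y] is inserted on both sides so that [xy] and [ymin]
     apply; its positivity allows this. *)
  have gy0 : (0 < g y)%N by apply: g_gt0; rewrite inE ys orbT.
  rewrite -(leq_pmul2r gy0) mulnAC (leq_trans (leq_mul xy (leqnn (g z)))) //.
  by rewrite mulnAC (mulnAC (f z)) leq_mul2r ymin ?orbT.
exists y; first by rewrite inE ys orbT.
by move=> z; rewrite inE => /predU1P [-> | /ymin //]; apply: ltnW.
Qed.

Lemma rational_ln_div (R : realType) (m n a b : nat) :
  (1 < m)%N -> (1 < n)%N -> (0 < a)%N -> (m ^ a = n ^ b)%N ->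
  rational (ln (m%:R : R) / ln (n%:R : R)).
Proof.
move=> m1 n1 a0 mnE; exists (b%:R / a%:R) => //.
rewrite fmorph_div /= !rmorph_nat.
have ln_n0 : ln (n%:R : R) != 0 by rewrite gt_eqF // ln_gt0 // ltr1n.
apply/eqP; rewrite eqr_div ?pnatr_eq0 -?lt0n // mulr_natl mulr_natr.
by rewrite -!lnXn ?ltr0n 1?ltnW // -!natrX mnE.
Qed.

Theorem theorem3p8 (R : realType) (m n : nat)
    (n_ge2 : (2 <= n)%N) (n_le_m : (n <= m)%N)
    (log_irrational : irrational (ln (m%:R : R) / ln (n%:R : R))) :
  is_far m (n%:R^-1 : R) \/
  (exists a b : nat,
     [/\ (1 <= a)%N, (1 <= b)%N & good_pair (m ^ a)%N (n ^ b)%N]).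
Proof.
have n0 : (0 < n)%N := ltnW n_ge2.
have m1 : (1 < m)%N := leq_trans n_ge2 n_le_m.
have m0 : (0 < m)%N := ltnW m1.
have [/allP pnm | /allPn [p]] := boolP (all (dvdn^~ m) (primes n)); last first.
  by rewrite mem_primes => /and3P [pp _ pn] pm; left; apply: is_far_inv pm.
right.
have primes_neq0 : primes n != [::].
  by rewrite -size_eq0 -lt0n -has_predT; apply/hasP; exists (pdiv n);
     rewrite // mem_primes pdiv_prime ?n0 ?pdiv_dvd.
have logn_gt0E q : (q \in primes n) = (0 < logn q n)%N by rewrite logn_gt0.
have [|p pn pmin] := exists_min_ratio _ (logn^~ m) (logn^~ n) _ primes_neq0.
  by move=> q; rewrite logn_gt0E.
have pp : prime p by move: pn; rewrite mem_primes => /andP [].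
have a0 : (0 < logn p n)%N by rewrite -logn_gt0E.
have b0 : (0 < logn p m)%N by rewrite logn_gt0 mem_primes pp m0 pnm.
exists (logn p n), (logn p m); split => //.
(* If [q] divides [n], this is the minimality of [p]; otherwise the left side is 0. It yields the
   support condition, the divisibility behind [L < M] and the comparison of valuations. *)
have log_le q : (logn q (n ^ logn p m) <= logn q (m ^ logn p n))%N.
  rewrite !lognX; have [qn | ] := boolP (q \in primes n).
    by rewrite (mulnC (logn p n)) pmin.
  by rewrite logn_gt0E -eqn0Ngt => /eqP ->; rewrite muln0.
have ma0 : (0 < m ^ logn p n)%N by rewrite expn_gt0 m0.
have nb0 : (0 < n ^ logn p m)%N by rewrite expn_gt0 n0.
split.
- by split; [rewrite -(exp1n (logn p n)) | rewrite -(exp1n (logn p m))];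
     rewrite ltn_exp2r.
- by move=> q _ q_gt0; apply: leq_trans (log_le q).
- rewrite ltn_neqAle; apply/andP; split; last first.
    apply: dvdn_leq => //; apply/dvdn_partP => // q.
    rewrite p_part => /[!mem_primes] /and3P [qp _ _].
    by rewrite pfactor_dvdn.
  apply/eqP => mnE; apply: log_irrational.
  exact: rational_ln_div a0 (esym mnE).
- by move=> q _; apply: log_le.
(* The exponents were chosen so that both valuations at [p] equal [logn p m * logn p n]. *)
- exists p; last by rewrite !lognX mulnC muln_gt0 a0 b0.
  by rewrite primesM // !primesX // pn orbT.
Qed.
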